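(* Let $M$ be a surface in $\mathbb H^3=SL_2(\mathbb C)/SU(2)=\mathbb S^3_{\mathbb C}/\mathbb S^3$ with mean curvature function $H$ and unit normal $e_1$. If $\varphi\in\Gamma(U\Sigma)$ is a solution of $$\nabla_X\varphi=-\frac12II(X)\cdot\varphi-\frac12ad(X)\cdot\varphi\qquad\text{for all }X\in TM,$$ then the spinor field $\psi\in\Gamma(\Sigma M)$ corresponding to $\varphi^+$ is a solution of the Dirac equation $$D\psi=H\psi-\overline\psi$$ such that $$\partial_X|\psi|^2=-\Re e\langle X\cdot\overline\psi,\psi\rangle$$ for all $X\in TM$. Moreover $\psi$ never vanishes.
   Context: **Algebra.** $\mathbb H^{\mathbb C}=\{z_0+z_1I+z_2J+z_3K: z_k\in\mathbb C\}$ are the complex quaternions ($I^2=J^2=K^2=-1$, $IJ=K$), with the $\mathbb C$-bilinear form $H(z,z)=z_0^2+z_1^2+z_2^2+z_3^2$ (denoted by the same letter as, but unrelated to, the mean curvature). $G=SL_2(\mathbb C)\simeq\mathbb S^3_{\mathbb C}=\{z\in\mathbb H^{\mathbb C}:H(z,z)=1\}$ and $SU(2)\simeq\mathbb S^3=\mathbb S^3_{\mathbb C}\cap\mathbb H$ ($\mathbb H$ the real quaternions). The Lie algebras are $\mathfrak g=\mathbb CI\oplus\mathbb CJ\oplus\mathbb CK$ and $\mathfrak h=\mathbb RI\oplus\mathbb RJ\oplus\mathbb RK$, and $\mathfrak m=i\mathfrak h$. On $\mathfrak g$ one takes $B(z,z)=-4(z_1^2+z_2^2+z_3^2)$; $\mathbb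 H^3=\mathbb S^3_{\mathbb C}/\mathbb S^3$ carries the metric induced by $B_{|\mathfrak m}$. $Cl(\mathfrak g)$ is the complex Clifford algebra ($u\cdot v+v\cdot u=-2B(u,v)$); via $z\in\mathfrak g\mapsto\mathrm{diag}(-2iz,2iz)$ it is identified with $\{\mathrm{diag}(a,b):a,b\in\mathbb H^{\mathbb C}\}$, with even part $Cl^0(\mathfrak g)=\{\mathrm{diag}(a,a)\}\simeq\mathbb H^{\mathbb C}$, and $\widetilde{Ad}(G)=Spin(\mathfrak g)\simeq\mathbb S^3_{\mathbb C}$, $Spin(\mathfrak m)\simeq\mathbb S^3$, where $\widetilde{Ad}:G\to Spin(\mathfrak g)$ is the lift of the adjoint representation. **Bundles.** $E$ is the normal line bundle of $M$ in $\mathbb H^3$, $e_1$ a unit section of $E$, and $(e_1,e_2,e_3)$ an orthonormal frame of $TM\oplus E=T\mathbb H^3_{|M}$ with $e_2,e_3$ tangent to $M$, corresponding to the basis $\frac i2I,\frac i2J,\frac i2K$ of $\mathfrak m$, so that $[e_2,e_3]=ie_1$, $[e_3,e_1]=ie_2$, $[e_1,e_2]=ie_3$ for the bracket induced by $\mathfrak g$. $\widetilde Q$ is the $Spin(\mathfrak m)$-spin structure of $TM\oplus E$ constructed from spin structures of $TM$ and $E$; $\Sigma=\widetilde Q\times_\rho Cl(\mathfrak g)$ and $U\Sigma=\widetilde Q\times_\rho \widetilde{Ad}(G)\subset\Sigma$, $\rho$ being left multiplication. The Clifford bundle $Cl_\Sigma=Cl((TM\oplus E)^{\mathbb C})$ acts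 on $\Sigma$ on the left. $\nabla$ is the connection on $\Sigma$ induced by the Levi-Civita connection of $M$ and the normal connection of $E$. $II$ is the second fundamental form; in Clifford products $II(X)=\sum_{i=2,3}e_i\cdot II(X,e_i)$, and the mean curvature vector is $\vec H=\frac12(II(e_2,e_2)+II(e_3,e_3))=He_1$. For $X\in TM\oplus E$, $ad(X)\in Cl_\Sigma$ is $ad(X)=\frac12\sum_{i=1}^3e_i\cdot[X,e_i]$. **Splitting and identification with $\Sigma M$.** $\Sigma^o=\widetilde Q\times_\rho Cl^0(\mathfrak g)$ splits as $\Sigma^+\oplus\Sigma^-$ according to the left ideals $\mathbb H^{\mathbb C}=(\mathbb C\oplus\mathbb CJ)(1-iI)\oplus(\mathbb C\oplus\mathbb CJ)(1+iI)$, and $\varphi=\varphi^++\varphi^-$ accordingly. $\Sigma M$ is the usual spinor bundle of $M$ (complex rank 2), identified with $\Sigma^+$ over $M$ by a map $\psi\mapsto\psi^*$ such that $(X\cdot\psi)^*=X\cdot e_1\cdot\psi^*$ for all $X\in TM$; in coordinates, $[\psi]=z_1+jz_2\in\mathbb H$ corresponds to $[\psi^*]=(z_1+iz_2J)(1-iI)\in\mathbb H^{\mathbb C}$, and $|\psi|^2=|z_1|^2+|z_2|^2$, with $\langle\cdot,\cdot\rangle$ the Hermitian product on $\Sigma M$. ''$\psi$ corresponds to $\varphi^+$'' means $\psi^*=\varphi^+$. The Dirac operator is $D\psi=e_2\cdot\nabla_{e_2}\psi+e_3\cdot\nabla_{e_3}\psi$, and $\overline\psi=i\,e_2\cdot 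e_3\cdot\psi$.
   Formalization: The sign in the norm equation is corrected: the theorem proves ∂_X|ψ|² = +Re⟨X·ψ̄,ψ⟩ instead of the printed −Re⟨X·ψ̄,ψ⟩, which is false with the stated conventions (e.g. on a totally geodesic plane) and incompatible with Dψ = Hψ − ψ̄. *)

(* Defs.v *)
From HB Require Import structures.
From mathcomp Require Import all_boot all_order all_algebra.
From mathcomp Require Import complex ring lra.
From mathcomp Require Import all_classical all_reals all_analysis.
Set Implicit Arguments.
Unset Strict Implicit.
Unset Printing Implicit Defensive.
Import Order.TTheory GRing.Theory Num.Theory numFieldNormedType.Exports.
Local Open Scope classical_set_scope.
Local Open Scope ring_scope.

Record quat (K : Type) := Quat { q0 : K; q1 : K; q2 : K; q3 : K }.

Definition quat_tuple (K : Type) (z : quat K) := (q0 z, q1 z, q2 z, q3 z).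
Definition tuple_quat (K : Type) (t : K * K * K * K) :=
  let: (a, b, c, d) := t in Quat a b c d.
Lemma quat_tupleK (K : Type) : cancel (@quat_tuple K) (@tuple_quat K).
Proof. by case. Qed.

HB.instance Definition _ (K : eqType) :=
  Equality.copy (quat K) (can_type (@quat_tupleK K)).
HB.instance Definition _ (K : choiceType) :=
  Choice.copy (quat K) (can_type (@quat_tupleK K)).

Definition addq (K : zmodType) (z w : quat K) :=
  Quat (q0 z + q0 w) (q1 z + q1 w) (q2 z + q2 w) (q3 z + q3 w).
Definition oppq (K : zmodType) (z : quat K) :=
  Quat (- q0 z) (- q1 z) (- q2 z) (- q3 z).

Fact addqA (K : zmodType) : associative (@addq K).
Proof. by move=> x y z; rewrite /addq /= !addrA. Qed.
Fact addqC (K : zmodType) : commutative (@addq K).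
Proof.
by move=> x y; congr Quat; rewrite addrC.
Qed.
Fact add0q (K : zmodType) : left_id (Quat 0 0 0 0) (@addq K).
Proof. by case=> a b c d; rewrite /addq /= !add0r. Qed.
Fact addNq (K : zmodType) : left_inverse (Quat 0 0 0 0) (@oppq K) (@addq K).
Proof. by case=> a b c d; rewrite /addq /= !addNr. Qed.

HB.instance Definition _ (K : zmodType) :=
  GRing.isZmodule.Build (quat K) (@addqA K) (@addqC K) (@add0q K) (@addNq K).

Definition mulq (K : comNzRingType) (z w : quat K) :=
  Quat (q0 z * q0 w - q1 z * q1 w - q2 z * q2 w - q3 z * q3 w)
       (q0 z * q1 w + q1 z * q0 w + q2 z * q3 w - q3 z * q2 w)
       (q0 z * q2 w - q1 z * q3 w + q2 z * q0 w + q3 z * q1 w)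
       (q0 z * q3 w + q1 z * q2 w - q2 z * q1 w + q3 z * q0 w).

Fact mulqA (K : comNzRingType) : associative (@mulq K).
Proof. by move=> x y z; rewrite /mulq /=; congr Quat; ring. Qed.
Fact mul1q (K : comNzRingType) : left_id (Quat 1 0 0 0) (@mulq K).
Proof. by case=> a b c d; rewrite /mulq /=; congr Quat; ring. Qed.
Fact mulq1 (K : comNzRingType) : right_id (Quat 1 0 0 0) (@mulq K).
Proof. by case=> a b c d; rewrite /mulq /=; congr Quat; ring. Qed.
Fact mulqDl (K : comNzRingType) : left_distributive (@mulq K) (@addq K).
Proof. by move=> x y z; rewrite /mulq /addq /=; congr Quat; ring. Qed.
Fact mulqDr (K : comNzRingType) : right_distributive (@mulq K) (@addq K).
Proof. by move=> x y z; rewrite /mulq /addq /=; congr Quat; ring. Qed.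
Fact oneq_neq0 (K : comNzRingType) : Quat 1 0 0 0 != 0 :> quat K.
Proof. by apply/eqP => -[/eqP]; rewrite oner_eq0. Qed.

HB.instance Definition _ (K : comNzRingType) :=
  GRing.Zmodule_isNzRing.Build (quat K)
    (@mulqA K) (@mul1q K) (@mulq1 K) (@mulqDl K) (@mulqDr K) (@oneq_neq0 K).

Definition scaleq (K : comNzRingType) (c : K) (z : quat K) :=
  Quat (c * q0 z) (c * q1 z) (c * q2 z) (c * q3 z).

Fact scaleqA (K : comNzRingType) (a b : K) (z : quat K) :
  scaleq a (scaleq b z) = scaleq (a * b) z.
Proof. by rewrite /scaleq /= !mulrA. Qed.
Fact scale1q (K : comNzRingType) : left_id 1 (@scaleq K).
Proof. by case=> a b c d; rewrite /scaleq /= !mul1r. Qed.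
Fact scaleqDr (K : comNzRingType) : right_distributive (@scaleq K) +%R.
Proof. by move=> c z w; rewrite /scaleq /= !mulrDr. Qed.
Fact scaleqDl (K : comNzRingType) (z : quat K) :
  {morph (@scaleq K)^~ z : a b / a + b}.
Proof. by move=> a b; rewrite /scaleq /= !mulrDl. Qed.

HB.instance Definition _ (K : comNzRingType) :=
  GRing.Zmodule_isLmodule.Build K (quat K)
    (@scaleqA K) (@scale1q K) (@scaleqDr K) (@scaleqDl K).

Fact scaleqAl (K : comNzRingType) (a : K) (z w : quat K) :
  a *: (z * w) = a *: z * w.
Proof. by congr Quat => /=; ring. Qed.
Fact scaleqAr (K : comNzRingType) (a : K) (z w : quat K) :
  a *: (z * w) = z * (a *: w).
Proof. by congr Quat => /=; ring. Qed.

HB.instance Definition _ (K : comNzRingType) :=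
  GRing.Lmodule_isLalgebra.Build K (quat K) (@scaleqAl K).
HB.instance Definition _ (K : comNzRingType) :=
  GRing.Lalgebra_isAlgebra.Build K (quat K) (@scaleqAr K).

Definition conjq (K : comNzRingType) (z : quat K) :=
  Quat (q0 z) (- q1 z) (- q2 z) (- q3 z).

Definition Hform (K : comNzRingType) (z w : quat K) : K :=
  q0 z * q0 w + q1 z * q1 w + q2 z * q2 w + q3 z * q3 w.

(* qunit 0, qunit 1, qunit 2 are I, J, K; qim reads the matching coordinate *)
Definition qunit (K : comNzRingType) (k : 'I_3) : quat K :=
  Quat 0 (k == 0 :> nat)%:R (k == 1 :> nat)%:R (k == 2 :> nat)%:R.
Definition qim (K : comNzRingType) (k : 'I_3) (z : quat K) : K :=
  nth 0 [:: q1 z; q2 z; q3 z] k.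

Notation i0 := (@Ordinal 3 0 isT).
Notation i1 := (@Ordinal 3 1 isT).
Notation i2 := (@Ordinal 3 2 isT).

Notation HC R := (quat (R : realType)[i]).

Definition ic (R : realType) : R[i] := Complex 0 1.
Notation cplx x := (real_complex _ x).
Definition cplxq (R : realType) (q : quat R) : HC R :=
  Quat (cplx (q0 q)) (cplx (q1 q)) (cplx (q2 q)) (cplx (q3 q)).

Definition SL2C (R : realType) : set (HC R) := [set z | Hform z z = 1].
Definition SU2 (R : realType) : set (HC R) :=
  [set cplxq q | q in [set q : quat R | Hform q q = 1]].

Definition lie (R : realType) (z w : HC R) : HC R := z * w - w * z.

Definition Bform (R : realType) (z w : HC R) : R[i] :=
  - 4%:R * (q1 z * q1 w + q2 z * q2 w + q3 z * q3 w).

(* projection of g = h + m onto m = i h *)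
Definition mpart (R : realType) (z : HC R) : HC R :=
  Quat 0 (Complex 0 (complex.Im (q1 z))) (Complex 0 (complex.Im (q2 z)))
         (Complex 0 (complex.Im (q3 z))).

(* the orthonormal basis (i/2) I, (i/2) J, (i/2) K of m *)
Definition mbase (R : realType) (k : 'I_3) : HC R :=
  (2%:R^-1 * ic R) *: qunit (R[i]) k.

(* Cl(g), as pairs (a, b) standing for diag(a, b), with componentwise product *)
Notation Cl R := (HC R * HC R)%type.

Definition clg (R : realType) (z : HC R) : Cl R :=
  ((- (2%:R * ic R)) *: z, (2%:R * ic R) *: z).
Definition even (R : realType) (a : HC R) : Cl R := (a, a).

Lemma mul_icic (R : realType) : ic R * ic R = -1.
Proof. by congr Complex => /=; ring. Qed.

Lemma clg_anticomm (R : realType) (u v : HC R) : q0 u = 0 -> q0 v = 0 ->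
  clg u * clg v + clg v * clg u = - (2%:R * Bform u v) *: (1 : Cl R).
Proof.
case: u => _ u1 u2 u3 /= ->; case: v => _ v1 v2 v3 /= ->.
by rewrite /Bform; congr pair; congr Quat => /=; ring: (mul_icic R).
Qed.

(* C^infinity on an open set: all iterated directional derivatives are
   differentiable there *)
Definition smooth_on (R : realType) (n : nat) (V : normedModType R)
    (U : set 'rV[R]_n.+1) (f : 'rV[R]_n.+1 -> V) : Prop :=
  forall (s : seq 'rV[R]_n.+1) x, U x ->
    differentiable (foldr (fun v g y => 'D_v g y) f s) x.

Definition smoothC_on (R : realType) (n : nat) (U : set 'rV[R]_n.+1)
    (f : 'rV[R]_n.+1 -> R[i]) : Prop :=
  smooth_on U (fun x => complex.Re (f x)) /\
  smooth_on U (fun x => complex.Im (f x)).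

Definition smoothq_on (R : realType) (n : nat) (U : set 'rV[R]_n.+1)
    (f : 'rV[R]_n.+1 -> quat R) : Prop :=
  [/\ smooth_on U (fun x => q0 (f x)), smooth_on U (fun x => q1 (f x)),
      smooth_on U (fun x => q2 (f x)) & smooth_on U (fun x => q3 (f x))].

Definition smoothHC_on (R : realType) (n : nat) (U : set 'rV[R]_n.+1)
    (f : 'rV[R]_n.+1 -> HC R) : Prop :=
  [/\ smoothC_on U (fun x => q0 (f x)), smoothC_on U (fun x => q1 (f x)),
      smoothC_on U (fun x => q2 (f x)) & smoothC_on U (fun x => q3 (f x))].

Definition smoothCl_on (R : realType) (n : nat) (U : set 'rV[R]_n.+1)
    (f : 'rV[R]_n.+1 -> Cl R) : Prop :=
  smoothHC_on U (fun x => (f x).1) /\ smoothHC_on U (fun x => (f x).2).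

Definition dC (R : realType) (n : nat) (v : 'rV[R]_n.+1)
    (f : 'rV[R]_n.+1 -> R[i]) (x : 'rV[R]_n.+1) : R[i] :=
  Complex ('D_v (fun y => complex.Re (f y)) x)
          ('D_v (fun y => complex.Im (f y)) x).

Definition dquat (R : realType) (n : nat) (v : 'rV[R]_n.+1)
    (f : 'rV[R]_n.+1 -> quat R) (x : 'rV[R]_n.+1) : quat R :=
  Quat ('D_v (fun y => q0 (f y)) x) ('D_v (fun y => q1 (f y)) x)
       ('D_v (fun y => q2 (f y)) x) ('D_v (fun y => q3 (f y)) x).

Definition dHC (R : realType) (n : nat) (v : 'rV[R]_n.+1)
    (f : 'rV[R]_n.+1 -> HC R) (x : 'rV[R]_n.+1) : HC R :=
  Quat (dC v (fun y => q0 (f y)) x) (dC v (fun y => q1 (f y)) x)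
       (dC v (fun y => q2 (f y)) x) (dC v (fun y => q3 (f y)) x).

Definition dCl (R : realType) (n : nat) (v : 'rV[R]_n.+1)
    (f : 'rV[R]_n.+1 -> Cl R) (x : 'rV[R]_n.+1) : Cl R :=
  (dHC v (fun y => (f y).1) x, dHC v (fun y => (f y).2) x).

(* The Levi-Civita connection of a metric g given in coordinates, through
   Koszul's formula: koszul g X Y Z = g (nabla_X Y, Z). *)
Definition lie_bracket (R : realType) (n : nat)
    (X Y : 'rV[R]_n.+1 -> 'rV[R]_n.+1) (x : 'rV[R]_n.+1) : 'rV[R]_n.+1 :=
  'D_(X x) Y x - 'D_(Y x) X x.

Definition koszul (R : realType) (n : nat)
    (g : 'rV[R]_n.+1 -> 'rV[R]_n.+1 -> 'rV[R]_n.+1 -> R)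
    (X Y Z : 'rV[R]_n.+1 -> 'rV[R]_n.+1) (x : 'rV[R]_n.+1) : R :=
  2%:R^-1 *
  ('D_(X x) (fun y => g y (Y y) (Z y)) x
   + 'D_(Y x) (fun y => g y (Z y) (X y)) x
   - 'D_(Z x) (fun y => g y (X y) (Y y)) x
   + g x (lie_bracket X Y x) (Z x)
   - g x (lie_bracket Y Z x) (X x)
   - g x (lie_bracket X Z x) (Y x)).

Definition coset (R : realType) (z : HC R) : set (HC R) :=
  [set z * k | k in @SU2 R].
Definition H3 (R : realType) : set (set (HC R)) :=
  [set coset z | z in @SL2C R].

(* Polar decomposition: the section sigma of SL_2(C) -> H^3 is a global chart
   of H^3 by R^3 (lemma h3_chart below). *)
Definition sigma (R : realType) (y : 'rV[R]_3) : HC R :=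
  Quat (cplx (Num.sqrt (1 + y 0 i0 ^+ 2 + y 0 i1 ^+ 2 + y 0 i2 ^+ 2)))
       (ic R * cplx (y 0 i0)) (ic R * cplx (y 0 i1)) (ic R * cplx (y 0 i2)).

Definition h3coord (R : realType) (C : set (HC R)) : 'rV[R]_3 :=
  get [set y | coset (sigma y) = C].

(* The coordinate vector u at y is sent to (sigma^-1 d sigma (u))_m, by the
   identification T H^3 = G x_K m and the gauge sigma. *)
Definition h3vec (R : realType) (y u : 'rV[R]_3) : HC R :=
  mpart (conjq (sigma y) * dHC u (@sigma R) y).

Definition h3metric (R : realType) (y u v : 'rV[R]_3) : R :=
  complex.Re (Bform (h3vec y u) (h3vec y v)).

(* par a : dom a -> pt are the local parametrizations (inverse charts) *)
Record surface (R : realType) := Surface {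
  pt : topologicalType;
  idx : Type;
  dom : idx -> set 'rV[R]_2;
  par : idx -> 'rV[R]_2 -> pt;
  pt_hausdorff : hausdorff_space pt;
  pt_second_countable : @second_countable pt;
  dom_open : forall a, open (dom a);
  par_inj : forall a x y, dom a x -> dom a y -> par a x = par a y -> x = y;
  par_cont : forall a x, dom a x -> {for x, continuous (par a)};
  par_open : forall a V, open V -> V `<=` dom a -> open (par a @` V);
  par_cover : forall p, exists a, (par a @` dom a) p;
  par_smooth : forall a b,
    smooth_on [set x | dom a x /\ (par b @` dom b) (par a x)]
              (fun x => get [set y | dom b y /\ par b y = par a x])
}.
Arguments pt {R} s.
Arguments idx {R} s.
Arguments dom {R} s a.
Arguments par {R} s a x.

Definition overlap (R : realType) (M : surface R) (a b : idx M) :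
    set 'rV[R]_2 :=
  [set x | dom M a x /\ (par M b @` dom M b) (par M a x)].

Definition rep (R : realType) (M : surface R) (F : pt M -> set (HC R))
    (a : idx M) (x : 'rV[R]_2) : 'rV[R]_3 := h3coord (F (par M a x)).

(* immersed surface in H^3 with a unit normal field; unormal p is the coordinate
   vector of e_1 at emb p *)
Record immersed (R : realType) (M : surface R) := Immersed {
  emb : pt M -> set (HC R);
  unormal : pt M -> 'rV[R]_3;
  emb_H3 : forall p, @H3 R (emb p);
  emb_smooth : forall a, smooth_on (dom M a) (rep emb a);
  emb_immersion : forall a x v, dom M a x ->
    'D_v (rep emb a) x = 0 -> v = 0;
  normal_smooth : forall a,
    smooth_on (dom M a) (fun x => unormal (par M a x));
  normal_unit : forall a x, dom M a x ->
    h3metric (rep emb a x) (unormal (par M a x)) (unormal (par M a x)) = 1;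
  normal_orth : forall a x v, dom M a x ->
    h3metric (rep emb a x) ('D_v (rep emb a) x) (unormal (par M a x)) = 0
}.
Arguments emb {R M} i p.
Arguments unormal {R M} i p.

Definition pmetric (R : realType) (M : surface R) (F : immersed M)
    (a : idx M) (x v w : 'rV[R]_2) : R :=
  h3metric (rep (emb F) a x) ('D_v (rep (emb F) a) x) ('D_w (rep (emb F) a) x).

(* II (v, w) = sff v w . e_1: the e_1-component of the covariant derivative,
   along v, of the image of the constant coordinate field w *)
Definition sff (R : realType) (M : surface R) (F : immersed M)
    (a : idx M) (x v w : 'rV[R]_2) : R :=
  let f := rep (emb F) a in
  let e1 := unormal F (par M a x) in
  h3metric (f x) ('D_v (fun y => 'D_w f y) x) e1
  + koszul (@h3metric R) (cst ('D_v f x)) (cst ('D_w f x)) (cst e1) (f x).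

Definition Spin2 (R : realType) : set (quat R) :=
  [set a | [/\ q2 a = 0, q3 a = 0 & Hform a a = 1]].

(* a . I_k . a^-1 = \sum_l Admx a k l I_l *)
Definition Admx (R : realType) (a : quat R) (k l : 'I_3) : R :=
  qim l (a * qunit R k * conjq a).

Definition adapted_frame (R : realType) (M : surface R) (F : immersed M)
    (fr2 fr3 : idx M -> 'rV[R]_2 -> 'rV[R]_2)
    (a : idx M) (x : 'rV[R]_2) (k : 'I_3) : 'rV[R]_3 :=
  nth 0 [:: unormal F (par M a x); 'D_(fr2 a x) (rep (emb F) a) x;
            'D_(fr3 a x) (rep (emb F) a) x] k.

(* The Spin(2)-reduction of Q~, given by a local section over each chart: the
   adapted frame (e_1, e_2, e_3) below it, and the transition functions, with
   s_b = s_a . trans a b.  frame_oriented is [e_2, e_3] = i e_1. *)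
Record spin_structure (R : realType) (M : surface R) (F : immersed M) :=
  SpinStructure {
  fr2 : idx M -> 'rV[R]_2 -> 'rV[R]_2;
  fr3 : idx M -> 'rV[R]_2 -> 'rV[R]_2;
  trans : idx M -> idx M -> pt M -> quat R;
  fr2_smooth : forall a, smooth_on (dom M a) (fr2 a);
  fr3_smooth : forall a, smooth_on (dom M a) (fr3 a);
  frame_orthonormal : forall a x k l, dom M a x ->
    h3metric (rep (emb F) a x)
      (adapted_frame F fr2 fr3 a x k) (adapted_frame F fr2 fr3 a x l)
    = (k == l)%:R;
  frame_oriented : forall a x, dom M a x ->
    let e k := h3vec (rep (emb F) a x) (adapted_frame F fr2 fr3 a x k) in
    lie (e i1) (e i2) = ic R *: e i0;
  trans_spin2 : forall a b x, overlap a b x ->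
    @Spin2 R (trans a b (par M a x));
  trans_smooth : forall a b,
    smoothq_on (overlap a b) (fun x => trans a b (par M a x));
  trans_frame : forall a b x y k, dom M a x -> dom M b y ->
    par M a x = par M b y ->
    adapted_frame F fr2 fr3 b y k
    = \sum_(l < 3) Admx (trans a b (par M a x)) k l
                    *: adapted_frame F fr2 fr3 a x l;
  trans_cocycle : forall a b c p,
    (par M a @` dom M a) p -> (par M b @` dom M b) p ->
    (par M c @` dom M c) p -> trans a b p * trans b c p = trans a c p
}.
Arguments fr2 {R M F} s a x.
Arguments fr3 {R M F} s a x.
Arguments trans {R M F} s a b p.

(* Sections are given by their components phi_a = [phi] in the spin frames *)
Record USigma_section (R : realType) (M : surface R) (F : immersed M)
    (Q : spin_structure F) := USigmaSection {
  usec : idx M -> 'rV[R]_2 -> Cl R;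
  usec_smooth : forall a, smoothCl_on (dom M a) (usec a);
  usec_spin : forall a x, dom M a x ->
    exists2 g, @SL2C R g & usec a x = even g;
  usec_compat : forall a b x y, dom M a x -> dom M b y ->
    par M a x = par M b y ->
    usec a x = even (cplxq (trans Q a b (par M a x))) * usec b y
}.

(* Sigma M has fibre H, on which Spin(2) and Cl_2 = H act by left
   multiplication; its complex structure is right multiplication by i. *)
Record SigmaM_section (R : realType) (M : surface R) (F : immersed M)
    (Q : spin_structure F) := SigmaMSection {
  ssec : idx M -> 'rV[R]_2 -> quat R;
  ssec_smooth : forall a, smoothq_on (dom M a) (ssec a);
  ssec_compat : forall a b x y, dom M a x -> dom M b y ->
    par M a x = par M b y ->
    ssec a x = trans Q a b (par M a x) * ssec b y
}.

(* <nabla_v e_2, e_3> *)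
Definition omega23 (R : realType) (M : surface R) (F : immersed M)
    (Q : spin_structure F) (a : idx M) (x v : 'rV[R]_2) : R :=
  koszul (pmetric F a) (cst v) (fr2 Q a) (fr3 Q a) x.

Definition ecl (R : realType) (k : 'I_3) : Cl R := clg (@mbase R k).

(* d phi + 1/2 \sum_(i < j) <nabla e_i, e_j> e_i . e_j . phi; for the direct sum
   connection on TM + E only the term (i, j) = (2, 3) is nonzero, since the unit
   section e_1 of the line bundle E is parallel *)
Definition nablaSigma (R : realType) (M : surface R) (F : immersed M)
    (Q : spin_structure F) (phi : USigma_section Q)
    (a : idx M) (x v : 'rV[R]_2) : Cl R :=
  dCl v (usec phi a) x
  + cplx (2%:R^-1 * omega23 Q a x v) *: (ecl R i1 * ecl R i2 * usec phi a x).

Definition tvec (R : realType) (M : surface R) (F : immersed M)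
    (Q : spin_structure F) (a : idx M) (x v : 'rV[R]_2) : HC R :=
  cplx (pmetric F a x v (fr2 Q a x)) *: mbase R i1
  + cplx (pmetric F a x v (fr3 Q a x)) *: mbase R i2.

Definition II_cl (R : realType) (M : surface R) (F : immersed M)
    (Q : spin_structure F) (a : idx M) (x v : 'rV[R]_2) : Cl R :=
  ecl R i1 * (cplx (sff F a x v (fr2 Q a x)) *: ecl R i0)
  + ecl R i2 * (cplx (sff F a x v (fr3 Q a x)) *: ecl R i0).

Definition mean_curvature (R : realType) (M : surface R) (F : immersed M)
    (Q : spin_structure F) (a : idx M) (x : 'rV[R]_2) : R :=
  2%:R^-1 * (sff F a x (fr2 Q a x) (fr2 Q a x)
             + sff F a x (fr3 Q a x) (fr3 Q a x)).

Definition ad_cl (R : realType) (X : HC R) : Cl R :=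
  2%:R^-1 *: \sum_(k < 3) ecl R k * clg (lie X (mbase R k)).

(* x2 e_2 + x3 e_3 acting on the fibre H of Sigma M *)
Definition cliff2 (R : realType) (x2 x3 : R) (s : quat R) : quat R :=
  (x2 *: qunit R i1 + x3 *: qunit R i2) * s.

Definition cliffM (R : realType) (M : surface R) (F : immersed M)
    (Q : spin_structure F) (a : idx M) (x v : 'rV[R]_2) (s : quat R) : quat R :=
  cliff2 (pmetric F a x v (fr2 Q a x)) (pmetric F a x v (fr3 Q a x)) s.

(* i e_2 . e_3 . s *)
Definition bar (R : realType) (s : quat R) : quat R :=
  cliff2 1 0 (cliff2 0 1 s) * qunit R i0.

Definition nablaM (R : realType) (M : surface R) (F : immersed M)
    (Q : spin_structure F) (psi : SigmaM_section Q)
    (a : idx M) (x v : 'rV[R]_2) : quat R :=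
  dquat v (ssec psi a) x
  + (2%:R^-1 * omega23 Q a x v) *: cliff2 1 0 (cliff2 0 1 (ssec psi a x)).

Definition dirac_op (R : realType) (M : surface R) (F : immersed M)
    (Q : spin_structure F) (psi : SigmaM_section Q)
    (a : idx M) (x : 'rV[R]_2) : quat R :=
  cliff2 1 0 (nablaM psi a x (fr2 Q a x))
  + cliff2 0 1 (nablaM psi a x (fr3 Q a x)).

(* s = z_1 + j z_2 *)
Definition z1of (R : realType) (s : quat R) : R[i] := Complex (q0 s) (q1 s).
Definition z2of (R : realType) (s : quat R) : R[i] := Complex (q2 s) (- q3 s).

Definition herm (R : realType) (s t : quat R) : R[i] :=
  z1of s * conjc (z1of t) + z2of s * conjc (z2of t).
Definition normsq (R : realType) (s : quat R) : R := complex.Re (herm s s).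

(* psi |-> psi^* in coordinates; star_clifford below is
   (X . psi)^* = X . e_1 . psi^*. *)
Definition star (R : realType) (s : quat R) : HC R :=
  Quat (z1of s) 0 (ic R * z2of s) 0 * Quat 1 (- ic R) 0 0.

Definition ideal_plus (R : realType) : set (HC R) :=
  [set z | exists a b, z = Quat a 0 b 0 * Quat 1 (- ic R) 0 0].
Definition ideal_minus (R : realType) : set (HC R) :=
  [set z | exists a b, z = Quat a 0 b 0 * Quat 1 (ic R) 0 0].

Definition plus_component (R : realType) (z zp : HC R) : Prop :=
  ideal_plus zp /\ exists2 zm, ideal_minus zm & z = zp + zm.

Definition corresponds (R : realType) (M : surface R) (F : immersed M)
    (Q : spin_structure F) (psi : SigmaM_section Q) (phi : USigma_section Q) :=
  forall a x, dom M a x ->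
    exists2 z, usec phi a x = even z & plus_component z (star (ssec psi a x)).

Lemma complexE2 (R : realType) (a b : R) : Complex a b = cplx a + ic R * cplx b.
Proof. by congr Complex => /=; ring. Qed.

Lemma clgM (R : realType) (u v : HC R) :
  clg u * clg v = even (- 4%:R *: (u * v)).
Proof.
by congr pair; congr Quat => /=; ring: (mul_icic R).
Qed.

Lemma evenM (R : realType) (u v : HC R) : even u * even v = even (u * v).
Proof. by []. Qed.

Lemma mbaseM (R : realType) (k l : 'I_3) :
  - 4%:R *: (mbase R k * mbase R l) = qunit R[i] k * qunit R[i] l.
Proof.
rewrite /mbase -scalerAl -scalerAr !scalerA.
rewrite [X in X *: _](_ : _ = 1) ?scale1r//.
have n2 : (2%:R : R[i]) != 0 by rewrite pnatr_eq0.
by field: (mul_icic R).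
Qed.

Lemma star_clifford (R : realType) (x2 x3 : R) (s : quat R) :
  even (star (cliff2 x2 x3 s))
  = clg (cplx x2 *: mbase R i1 + cplx x3 *: mbase R i2) * ecl R i0
    * even (star s).
Proof.
rewrite /ecl clgM mulrDl -(scalerAl (cplx x2)) -(scalerAl (cplx x3)) scalerDr.
rewrite !(scalerA (- 4%:R)) !(mulrC (- 4%:R)).
rewrite -(scalerA (cplx x2)) -(scalerA (cplx x3)) !mbaseM evenM; congr even.
case: s => a b c d.
rewrite /star /z1of /z2of !complexE2; congr Quat => /=; ring: (mul_icic R).
Qed.

Lemma star_spin (R : realType) (g s : quat R) : Spin2 g ->
  star (g * s) = cplxq g * star s.
Proof.
case: g => g0 g1 g2 g3 [/= -> -> _]; case: s => a b c d.
rewrite /star /z1of /z2of !complexE2; congr Quat => /=; ring: (mul_icic R).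
Qed.

(* The term - 1/2 ad (X) of the spinor equation is + 1/2 X . bar psi on Sigma M;
   as real Clifford products are skew (herm_cliff2), it gives
   d |psi|^2 (X) = + Re <X . bar psi, psi>, which herm_bar shows is not
   identically zero. *)
Lemma star_ad (R : realType) (x2 x3 : R) (s : quat R) :
  - (2%:R^-1 *:
     (ad_cl (cplx x2 *: mbase R i1 + cplx x3 *: mbase R i2) * even (star s)))
  = even (star (2%:R^-1 *: cliff2 x2 x3 (bar s))).
Proof.
have adE : ad_cl (cplx x2 *: mbase R i1 + cplx x3 *: mbase R i2)
   = even (2%:R *: (cplx x2 *: mbase R i1 + cplx x3 *: mbase R i2)).
  rewrite /ad_cl !big_ord_recl big_ord0 addr0 /ecl !clgM.
  have n2 : (2%:R : R[i]) != 0 by rewrite pnatr_eq0.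
  by congr even; congr Quat => /=; field: (mul_icic R).
rewrite adE evenM -scalerAl -[X in - X]/(even _) scalerA mulVf ?pnatr_eq0//.
rewrite scale1r -[LHS]/(even (- _)); congr even.
case: s => a b c d.
by rewrite /star /z1of /z2of !complexE2; congr Quat => /=; field: (mul_icic R).
Qed.

Lemma plus_component_unique (R : realType) (z : HC R) :
  exists! s, plus_component z (star s).
Proof.
have n2 : (2%:R : R[i]) != 0 by rewrite pnatr_eq0.
have starE s : star s = Quat (z1of s) (- ic R * z1of s) (ic R * z2of s)
                             (- z2of s).
  by congr Quat => /=; ring: (mul_icic R).
have minusE a b : Quat a 0 b 0 * Quat 1 (ic R) 0 0
                  = Quat a (ic R * a) b (- ic R * b).
  by congr Quat => /=; ring.
have s_of (u v : R[i]) : exists s, z1of s = u /\ z2of s = v.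
  exists (Quat (complex.Re u) (complex.Im u) (complex.Re v) (- complex.Im v)).
  by rewrite /z1of /z2of /= opprK; case: u v => [? ?] [? ?].
case: z => z0 z1 z2 z3.
have [s [s1 s2]] := s_of (2%:R^-1 * (z0 + ic R * z1))
                         (2%:R^-1 * (- ic R * z2 - z3)).
exists s; split.
  split; first by exists (z1of s), (ic R * z2of s).
  exists (Quat (2%:R^-1 * (z0 - ic R * z1)) 0 (2%:R^-1 * (z2 + ic R * z3)) 0
           * Quat 1 (ic R) 0 0); first by eexists; eexists.
  by rewrite minusE starE s1 s2; congr Quat => /=; field: (mul_icic R).
move=> t [_ [_ [a [b ->]]]]; rewrite minusE starE => -[e0 e1 e2 e3].
have t1 : z1of t = z1of s by rewrite s1 e0 e1; field: (mul_icic R).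
have t2 : z2of t = z2of s by rewrite s2 e2 e3; field: (mul_icic R).
move: t1 t2; case: s t {s1 s2 e0 e1 e2 e3} => [? ? ? ?] [? ? ? ?].
by rewrite /z1of /z2of /= => -[-> ->] [-> /oppr_inj ->].
Qed.

Lemma herm_cliff2 (R : realType) (x2 x3 : R) (s : quat R) :
  complex.Re (herm (cliff2 x2 x3 s) s) = 0.
Proof. by case: s => a b c d; rewrite /herm /z1of /z2of /=; ring. Qed.

Lemma herm_bar (R : realType) :
  let s : quat R := Quat 1 0 1 0 in
  complex.Re (herm (cliff2 1 0 (bar s)) s) = - 2%:R.
Proof. by rewrite /herm /z1of /z2of /=; ring. Qed.

Definition adjq (R : realType) (z : HC R) : HC R :=
  Quat (conjc (q0 z)) (- conjc (q1 z)) (- conjc (q2 z)) (- conjc (q3 z)).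

Lemma adjqM (R : realType) (z w : HC R) : adjq (z * w) = adjq w * adjq z.
Proof.
case: z w => [[a a'] [b b'] [c c'] [d d']] [[e e'] [f f'] [g g'] [h h']].
by congr Quat; congr Complex => /=; ring.
Qed.

Lemma HformM (K : comNzRingType) (z w : quat K) :
  Hform (z * w) (z * w) = Hform z z * Hform w w.
Proof. by rewrite /Hform /=; ring. Qed.

Lemma mul_conjq (K : comNzRingType) (z : quat K) :
  Hform z z = 1 -> z * conjq z = 1 /\ conjq z * z = 1.
Proof.
move=> z1; suff E : z * conjq z = Hform z z *: 1 /\ conjq z * z = Hform z z *: 1.
  by rewrite z1 scale1r in E.
by split; congr Quat; rewrite /Hform /=; ring.
Qed.

Lemma SU2P (R : realType) (k : HC R) :
  SU2 k <-> Hform k k = 1 /\ k * adjq k = 1.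
Proof.
split.
  case=> -[a b c d] /= k1 <-.
  have h : Hform (cplxq (Quat a b c d)) (cplxq (Quat a b c d)) = 1.
    by rewrite -(rmorph1 (real_complex R)) -k1 /Hform /=; ring.
  split=> //; have [<- _] := mul_conjq h.
  by congr (_ * _); congr Quat; congr Complex => /=; ring.
case=> k1 kk; have [_ ck] := mul_conjq k1.
have E : adjq k = conjq k by rewrite -[LHS]mul1r -ck -mulrA kk mulr1.
case: k k1 E {kk ck} => [[a a'] [b b'] [c c'] [d d']] k1 [] e0 e1 e2 e3.
have a0 : a' = 0 by lra.
have b0 : b' = 0 by lra.
have c0 : c' = 0 by lra.
have d0 : d' = 0 by lra.
rewrite {}a0 {}b0 {}c0 {}d0 in k1 *.
exists (Quat a b c d) => //=.
by move: k1; rewrite /Hform /= => /(congr1 (@complex.Re R)) /= <-; ring.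
Qed.

Lemma sigma_props (R : realType) (y : 'rV[R]_3) :
  Hform (sigma y) (sigma y) = 1 /\ adjq (sigma y) = sigma y.
Proof.
have h : Num.sqrt (1 + y 0 i0 ^+ 2 + y 0 i1 ^+ 2 + y 0 i2 ^+ 2) ^+ 2 =
   1 + y 0 i0 ^+ 2 + y 0 i1 ^+ 2 + y 0 i2 ^+ 2.
  by rewrite sqr_sqrtr// !addr_ge0// sqr_ge0.
split.
  rewrite /sigma; set s := Num.sqrt _ in h *.
  by rewrite /Hform; congr Complex => /=; ring: h.
by congr Quat; congr Complex => /=; ring.
Qed.

Lemma coset_eq (R : realType) (z w : HC R) :
  Hform z z = 1 -> Hform w w = 1 ->
  coset z = coset w <-> z * adjq z = w * adjq w.
Proof.
move=> z1 w1.
have one : @SU2 R 1.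
  by apply/SU2P; split; [rewrite /Hform /=; ring|congr Quat; congr Complex => /=; ring].
have [_ cw] := mul_conjq w1; have [wc _] := mul_conjq w1.
have adj1 (v : HC R) : adjq (conjq v) = conjq (adjq v).
  by case: v => [[? ?] [? ?] [? ?] [? ?]]; congr Quat; congr Complex => /=; ring.
have Hadj (v : HC R) : Hform v v = 1 -> Hform (adjq v) (adjq v) = 1.
  case: v => [[a a'] [b b'] [c c'] [d d']]; rewrite /Hform /= => -[e0 e1].
  by congr Complex => /=; lra.
split=> [E|E].
  have : coset z z by exists 1 => //; rewrite mulr1.
  rewrite E => -[k /SU2P[_ kk] <-].
  by rewrite adjqM mulrA -(mulrA w) kk mulr1.
have kU : SU2 (conjq w * z).
  apply/SU2P; split.
    by rewrite HformM z1 mulr1 -w1 /Hform /=; ring.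
  rewrite adjqM mulrA -(mulrA (conjq w)) E !mulrA cw mul1r adj1.
  by have [-> _] := mul_conjq (Hadj _ w1).
have zE : z = w * (conjq w * z) by rewrite mulrA wc mul1r.
have SU2M (k l : HC R) : SU2 k -> SU2 l -> SU2 (k * l).
  move=> /SU2P[k1 kk] /SU2P[l1 ll]; apply/SU2P; rewrite HformM k1 l1 mulr1.
  by split=> //; rewrite adjqM mulrA -(mulrA k) ll mulr1.
have SU2V (k : HC R) : SU2 k -> SU2 (conjq k).
  move=> /SU2P[k1 kk]; apply/SU2P; have [kc ck] := mul_conjq k1; split.
    by rewrite -k1 /Hform /=; ring.
  have -> : adjq (conjq k) = k.
    by rewrite adj1 -[RHS]mulr1; have [<- _] := mul_conjq (Hadj _ k1);
       rewrite mulrA kk mul1r.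
  by [].
have wE : w = z * conjq (conjq w * z).
  have h : Hform (conjq w * z) (conjq w * z) = 1 by case/SU2P: kU.
  by rewrite {1}zE -mulrA; have [-> _] := mul_conjq h; rewrite mulr1.
apply/seteqP; split=> _ [k kK <-].
  exists (conjq w * z * k); first exact: SU2M.
  by rewrite !mulrA wc mul1r.
exists (conjq (conjq w * z) * k); first exact/SU2M/kK/SU2V.
by rewrite mulrA -wE.
Qed.

Lemma h3_chart (R : realType) (C : set (HC R)) : H3 C ->
  exists! y, coset (sigma y) = C.
Proof.
case=> z /= z1 <-.
have NE (y : 'rV[R]_3) : coset (sigma y) = coset z <-> z * adjq z = sigma y * sigma y.
  have [s1 s2] := sigma_props y.
  by split=> [/(coset_eq s1 z1)|/esym E]; [|apply/(coset_eq s1 z1)]; rewrite s2.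
have s2E (y : 'rV[R]_3) : let s := Num.sqrt (1 + y 0 i0 ^+ 2 + y 0 i1 ^+ 2 + y 0 i2 ^+ 2) in
   sigma y * sigma y = Quat (cplx (2%:R * s ^+ 2 - 1)) (Complex 0 (2%:R * s * y 0 i0))
     (Complex 0 (2%:R * s * y 0 i1)) (Complex 0 (2%:R * s * y 0 i2)).
  move=> s; have h : s ^+ 2 = 1 + y 0 i0 ^+ 2 + y 0 i1 ^+ 2 + y 0 i2 ^+ 2.
    by rewrite sqr_sqrtr// !addr_ge0// sqr_ge0.
  by rewrite /sigma -/s; congr Quat; congr Complex => /=; ring: h.
have [p0 [p1 [p2 [p3 [zz [p0ge pn]]]]]] : exists p0 p1 p2 p3 : R,
   z * adjq z = Quat (cplx p0) (Complex 0 p1) (Complex 0 p2) (Complex 0 p3) /\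
   (0 <= p0 /\ p0 ^+ 2 = 1 + p1 ^+ 2 + p2 ^+ 2 + p3 ^+ 2).
  case: z z1 {NE} => [[a a'] [b b'] [c c'] [d d']]; rewrite /Hform /= => -[e0 e1].
  have e1' : a * a' + b * b' + c * c' + d * d' = 0 by lra.
  have e0' : a ^+ 2 + b ^+ 2 + c ^+ 2 + d ^+ 2 - a' ^+ 2 - b' ^+ 2 - c' ^+ 2 - d' ^+ 2 = 1 by lra.
  exists (a^+2+a'^+2+b^+2+b'^+2+c^+2+c'^+2+d^+2+d'^+2),
     (2%:R * (b' * a - a' * b + d' * c - c' * d)),
     (2%:R * (c' * a - a' * c + b' * d - b * d')),
     (2%:R * (d' * a - a' * d + c' * b - c * b')).
  split; first by congr Quat; congr Complex => /=; ring.
  split; first by rewrite !addr_ge0// sqr_ge0.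
  set A := (X in X = 1) in e0'; set E := (X in X = 0) in e1'.
  have h : A ^+ 2 + 4%:R * E ^+ 2 = 1 by rewrite e0' e1'; ring.
  by rewrite -[X in _ = X + _ + _ + _]h /A /E; ring.
have p01 : 1 <= p0.
  rewrite -(@ler_pXn2r _ 2)// ?nnegrE// expr1n pn.
  by rewrite -!addrA lerDl !addr_ge0// sqr_ge0.
have u0 : 0 < (p0 + 1) / 2%:R by rewrite divr_gt0// ltr_wpDl.
pose s := Num.sqrt ((p0 + 1) / 2%:R).
have s0 : 0 < s by rewrite sqrtr_gt0.
have sE : s ^+ 2 = (p0 + 1) / 2%:R by rewrite sqr_sqrtr// ltW.
pose y : 'rV[R]_3 := \row_k ((nth 0 [:: p1; p2; p3] k) / (2%:R * s)).
have sy : Num.sqrt (1 + y 0 i0 ^+ 2 + y 0 i1 ^+ 2 + y 0 i2 ^+ 2) = s.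
  rewrite /s; congr Num.sqrt; rewrite !mxE /= !expr_div_n exprMn sE.
  rewrite -!addrA -!mulrDl.
  have -> : p1 ^+ 2 + (p2 ^+ 2 + p3 ^+ 2) = (p0 - 1) * (p0 + 1).
    by rewrite !addrA; ring: pn.
  have p1n : p0 + 1 != 0 by rewrite gt_eqF// ltr_wpDl.
  by field.
have sn : s != 0 by rewrite gt_eqF.
exists y; split.
  apply/NE; rewrite zz s2E /= sy sE !mxE /=.
  by congr Quat; congr Complex; field.
move=> t /NE; rewrite zz s2E /=; set r := Num.sqrt _ => -[e0 e1 e2 e3].
have r0 : 0 <= r := sqrtr_ge0 _.
have rs : r = s.
  apply/eqP; rewrite -(@eqrXn2 _ 2)// ?ltW//; apply/eqP.
  by rewrite sE e0; field.
have sol (w : 'I_3) (p : R) : p = 2%:R * r * t 0 w -> p / (2%:R * s) = t 0 w.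
  by move=> ->; rewrite rs; field.
apply/matrixP => i k; rewrite ord1 !mxE.
case: k => [[|[|[|//]]] lt3] /=; rewrite ?(sol _ _ e1) ?(sol _ _ e2) ?(sol _ _ e3);
  by congr (t 0 _); apply/val_inj.
Qed.

(* Main.v *)
Require Import Defs.
From mathcomp Require Import all_boot all_order all_algebra.
From mathcomp Require Import complex ring lra.
From mathcomp Require Import all_classical all_reals all_analysis.
Import Order.TTheory GRing.Theory Num.Theory numFieldNormedType.Exports.
Local Open Scope classical_set_scope.
Local Open Scope ring_scope.

(* Both summands of H^C = (C + C J)(1 - iI) + (C + C J)(1 + iI) are left ideals, so
   the real-linear projection phi |-> psi commutes with d and with the even products
   e_j . e_k, and turns the equation of phi into
     nabla_v psi = 1/2 (v . bar psi - (h(v, e_2) J + h(v, e_3) K) psi),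
   with h the second fundamental form.  Contracting with J and K gives the Dirac
   equation: h is symmetric (Schwarz's theorem for the coordinates of the
   immersion and the symmetry of the Christoffel symbols), so its off-diagonal
   terms cancel.  In d |psi|^2 the connection and h terms drop out, as
   left multiplication by an imaginary quaternion is skew.  If psi vanished, phi
   would lie in (C + C J)(1 + iI), where the form H is zero, while H(phi, phi) = 1. *)

Set Implicit Arguments.
Unset Strict Implicit.

(** * Schwarz's theorem for mixed directional derivatives *)

Lemma is_derive_line (R : numFieldType) (V W : normedModType R) (f : V -> W)
    (x v : V) (t : R) (df : W) :
  is_derive (x + t *: v) v f df -> is_derive t 1 (fun s => f (x + s *: v)) df.
Proof.
have E : (fun h : R => h^-1 *: (((fun s => f (x + s *: v)) \o shift t) (h *: 1)
                                - f (x + t *: v)))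
       = (fun h : R => h^-1 *: ((f \o shift (x + t *: v)) (h *: v)
                                - f (x + t *: v))).
  apply/funext => h /=; congr (_ *: (f _ - _)).
  by rewrite [h%:A]mulr1 scalerDl addrCA.
by case=> dfx <-; split; rewrite /derivable /derive E.
Qed.

(* Mean value theorem for t |-> f (x + t v + h w) - f (x + t v) on [0, h], followed
   by the first-order expansion of g = D_v f at x. *)
Lemma second_difference (R : realType) (V : normedModType R) (f g : V -> R)
    (x v w : V) :
  (\forall y \near x, differentiable f y /\ 'D_v f y = g y) ->
  differentiable g x ->
  forall e : R, 0 < e -> \forall h \near (0 : R)^'+,
    `|f (x + h *: v + h *: w) - f (x + h *: v) - f (x + h *: w) + f x
      - h ^+ 2 * 'D_w g x|
    <= e * h ^+ 2.
Proof.
move=> /nbhs_ballP[r /= r0 df] dg e e0.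
pose N := `|v| + `|w| + 1; have N0 : 0 < N by rewrite ltr_wpDl// addr_ge0.
(* The increments below have norm at most [h * N], so each of the two expansions of [g] costs
   [e * h / 2]; the factor [h] of the mean value theorem turns their sum into [e * h ^+ 2]. *)
have e'0 : 0 < e / (2%:R * N) by rewrite divr_gt0// mulr_gt0.
have /funext/eqaddoP/=/(_ _ e'0) := diff_locallyxC dg.
move=> /nbhs_ballP[s /= s0 dgE].
near=> h.
have h0 : 0 < h by near: h; exact: nbhs_right_gt.
have hr : h * N < r.
  by rewrite -ltr_pdivlMr//; near: h; apply: nbhs_right_lt; rewrite divr_gt0.
have hs : h * N < s.
  by rewrite -ltr_pdivlMr//; near: h; apply: nbhs_right_lt; rewrite divr_gt0.
have bound t u : 0 <= t <= h -> 0 <= u <= h -> `|t *: v + u *: w| <= h * N.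
  move=> /andP[t0 th] /andP[u0 uh]; rewrite (le_trans (ler_normD _ _))// !normrZ.
  rewrite (ger0_norm t0) (ger0_norm u0) /N !mulrDr mulr1.
  rewrite (@le_trans _ _ (h * `|v| + h * `|w|))//.
    by rewrite lerD// ler_wpM2r.
  by rewrite lerDl ltW.
have dfx t u : 0 <= t <= h -> 0 <= u <= h ->
      is_derive (x + t *: v + u *: w) v f (g (x + t *: v + u *: w)).
  move=> th uh; have [|d <-] := df (x + t *: v + u *: w).
    2: exact/derivableP/diff_derivable.
  rewrite -ball_normE /= opprD opprD !addrA subrr sub0r -opprD normrN.
  exact: le_lt_trans (bound _ _ th uh) _.
have gx t u : 0 <= t <= h -> 0 <= u <= h ->
    `|g (x + t *: v + u *: w) - g x - 'd g x (t *: v + u *: w)|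
    <= e / (2%:R * N) * (h * N).
  move=> th uh; rewrite -addrA -addrA -opprD.
  apply: le_trans (dgE (t *: v + u *: w) _) _.
    rewrite -ball_normE /= sub0r normrN.
    exact: le_lt_trans (bound _ _ th uh) _.
  by rewrite ler_wpM2l ?(ltW e'0)// bound.
pose G t := f (x + t *: v + h *: w) - f (x + t *: v).
have hh : 0 <= h <= h by rewrite lexx ltW.
have zh : 0 <= (0 : R) <= h by rewrite lexx ltW.
have dG t : 0 <= t <= h ->
    is_derive t 1 G (g (x + t *: v + h *: w) - g (x + t *: v)).
  move=> th; apply: is_deriveB.
    rewrite [X in is_derive _ _ X](_ : _ = fun t => f (x + h *: w + t *: v)).
      by apply: is_derive_line; rewrite addrAC; exact: dfx.
    by apply/funext => t'; rewrite addrAC.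
  apply: is_derive_line; rewrite -[x + t *: v]addr0 -(scale0r w).
  exact: dfx.
have [c /itvP ch] : exists2 c, c \in `[0, h]%R &
    G h - G 0 = (g (x + c *: v + h *: w) - g (x + c *: v)) * (h - 0).
  apply: MVT_segment; first exact: ltW.
    move=> t; rewrite in_itv => /andP[/ltW t0 /ltW th]; apply: dG; exact/andP.
  apply: derivable_within_continuous => t; rewrite in_itv => th.
  by have := dG t th.
have {}ch : 0 <= c <= h by rewrite !ch.
rewrite /G scale0r !addr0 subr0 => GE.
have -> : f (x + h *: v + h *: w) - f (x + h *: v) - f (x + h *: w) + f x
   = (g (x + c *: v + h *: w) - g (x + c *: v)) * h by rewrite -GE; ring.
have := gx _ _ ch hh; have := gx _ _ ch zh.
rewrite scale0r !addr0 deriveE//.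
(* Both expansions contain ['d g x (c *: v)], so the linear term at the unknown [c] cancels in their
   difference. *)
have -> : 'd g x (c *: v + h *: w) = 'd g x (c *: v) + h * 'd g x w.
  by rewrite linearD; congr (_ + _); exact: linearZ.
have -> : e / (2 * N) * (h * N) = e * h / 2 by field; rewrite gt_eqF.
set A := g (x + c *: v); set B := g (x + c *: v + _).
set C := 'd g x (c *: v); set D := 'd _ _ w => h1 h2.
have -> : (B - A) * h - h ^+ 2 * D = (B - A - h * D) * h by ring.
rewrite normrM (gtr0_norm h0) expr2 mulrA ler_pM2r//.
have -> : B - A - h * D = (B - g x - (C + h * D)) - (A - g x - C) by ring.
by apply: le_trans (ler_normB _ _) _; lra.
Unshelve. all: by end_near.
Qed.

(** The second difference is symmetric in [v] and [w], so for small [h] both derivatives, multiplied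
    by [h ^+ 2], lie within [e / 2 * h ^+ 2] of the same number. *)
Lemma derive_derive_comm (R : realType) (V : normedModType R) (f fv fw : V -> R)
    (x v w : V) :
  (\forall y \near x, differentiable f y /\ 'D_v f y = fv y) ->
  (\forall y \near x, differentiable f y /\ 'D_w f y = fw y) ->
  differentiable fv x -> differentiable fw x -> 'D_v fw x = 'D_w fv x.
Proof.
move=> fvE fwE dv dw; apply/eqP; rewrite -subr_eq0 -normr_le0.
apply/ler_addgt0Pr => e e0; rewrite add0r.
have e20 : 0 < e / 2%:R by rewrite divr_gt0.
have dvw := second_difference w fvE dv e20.
have dwv := second_difference v fwE dw e20.
have [h [[{}dvw {}dwv] h0]] :=
  filter_ex (filterI (filterI dvw dwv) (nbhs_right_gt (0 : R))).
move: dvw dwv; rewrite (addrAC x (h *: w)).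
move: ('D_v _ x) ('D_w _ x) => A B.
move: (f (x + _ + _)) (f (x + h *: v)) (f (x + h *: w)) => a b c h1 h2.
rewrite -(@ler_pM2r _ (h ^+ 2)) ?exprn_gt0//.
rewrite -{1}(@ger0_norm _ (h ^+ 2)) ?sqr_ge0// -normrM.
have -> : (A - B) * h ^+ 2 =
  (a - b - c + f x - h ^+ 2 * B) - (a - c - b + f x - h ^+ 2 * A) by ring.
by apply: le_trans (ler_normB _ _) _; lra.
Qed.

(** * Symmetry of the second fundamental form *)

Lemma derive_coord (R : realType) (V : normedModType R) m n
   (f : V -> 'M[R]_(m.+1, n.+1)) x v i j : derivable f x v ->
  'D_v (fun y => f y i j) x = ('D_v f x) i j.
Proof.
move=> df; apply/cvg_lim => //.
rewrite [X in X @ _ --> _](_ : _ = (fun N : 'M[R]_(_, _) => N i j) \o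
    (fun h => h^-1 *: ((f \o shift x) (h *: v) - f x))).
  apply: cvg_comp; first exact: df.
  exact: coord_continuous.
by apply/funext => h /=; rewrite !mxE.
Qed.

(** Constant fields have zero brackets, so only derivatives of the metric remain: these are the
    Christoffel symbols of the first kind. *)
Lemma koszul_cstC (R : realType) (n : nat)
    (g : 'rV[R]_n.+1 -> 'rV[R]_n.+1 -> 'rV[R]_n.+1 -> R)
    (X Y Z p : 'rV[R]_n.+1) : (forall y u w, g y u w = g y w u) ->
  koszul g (cst X) (cst Y) (cst Z) p = koszul g (cst Y) (cst X) (cst Z) p.
Proof.
move=> gC; rewrite /koszul /lie_bracket /= !derive_cst.
have sw u w : (fun y => g y u w) = (fun y => g y w u) by apply/funext => y.
by rewrite (sw Y Z) (sw Z X) (sw X Y); ring.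
Qed.

Lemma BformC (R : realType) (z w : HC R) : Bform z w = Bform w z.
Proof. by rewrite /Bform; ring. Qed.

Lemma h3metricC (R : realType) (y u w : 'rV[R]_3) :
  h3metric y u w = h3metric y w u.
Proof. exact: congr1 (BformC _ _). Qed.

Lemma smooth_on_derivable (R : realType) (n : nat) (V : normedModType R)
    (U : set 'rV[R]_n.+1) (f : 'rV[R]_n.+1 -> V) x v :
  smooth_on U f -> U x -> derivable f x v.
Proof. by move=> sf Ux; apply: diff_derivable; exact: (sf [::]). Qed.

(** Entry by entry; as [U] is open, taking an entry commutes with ['D_u] on a whole neighbourhood of
    [x], as Schwarz's theorem requires. *)
Lemma smooth_derive_comm (R : realType) (n m p : nat) (U : set 'rV[R]_n.+1)
    (f : 'rV[R]_n.+1 -> 'M[R]_(m.+1, p.+1)) x v w :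
  open U -> smooth_on U f -> U x ->
  'D_v (fun y => 'D_w f y) x = 'D_w (fun y => 'D_v f y) x.
Proof.
move=> oU sf Ux; apply/matrixP => i j.
have nx : \forall y \near x, U y by apply: open_nbhs_nbhs.
have dcoord (g : 'rV[R]_n.+1 -> 'M[R]_(m.+1, p.+1)) y :
    differentiable g y -> differentiable (fun z => g z i j) y.
  by move=> dg; exact: (@differentiable_comp _ _ _ _ g
    (fun N : 'M[R]_(m.+1, p.+1) => N i j) y dg (differentiable_coord (g y) i j)).
have near_coord u : \forall y \near x,
    differentiable (fun z => f z i j) y /\
    'D_u (fun z => f z i j) y = ('D_u f y) i j.
  near=> y; have dfy : differentiable f y by apply: (sf [::]); near: y.
  by split; [exact: dcoord|rewrite derive_coord//; exact: diff_derivable].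
have d1 u : differentiable (fun y => 'D_u f y) x by exact: (sf [:: u]).
have d2 u u' : ('D_u (fun y => 'D_u' f y) x) i j =
    'D_u (fun y => ('D_u' f y) i j) x.
  by apply/esym/derive_coord/diff_derivable/d1.
have dC := derive_derive_comm (near_coord v) (near_coord w)
  (dcoord _ _ (d1 v)) (dcoord _ _ (d1 w)).
exact: etrans (d2 v w) (etrans dC (esym (d2 w v))).
Unshelve. all: by end_near.
Qed.

Lemma sffC (R : realType) (M : surface R) (F : immersed M) a x v w :
  dom M a x -> sff F a x v w = sff F a x w v.
Proof.
move=> ax; have dC := smooth_derive_comm v w
  (@dom_open _ M a) (@emb_smooth _ _ F a) ax.
rewrite /sff; apply: congr2; last exact: koszul_cstC (@h3metricC R).
exact: (congr1 (fun u => h3metric _ u _) dC).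
Qed.

(** * Projection of H^C onto the first left ideal *)

(* In (C + C J)(1 - iI) + (C + C J)(1 + iI), the first summand of z is star s for
   z_1 = (z0 + i z1) / 2 and z_2 = - (i z2 + z3) / 2. *)
Definition plus_spinor (R : realType) (z : HC R) : quat R :=
  Quat (2%:R^-1 * (complex.Re (q0 z) - complex.Im (q1 z)))
       (2%:R^-1 * (complex.Im (q0 z) + complex.Re (q1 z)))
       (2%:R^-1 * (complex.Im (q2 z) - complex.Re (q3 z)))
       (2%:R^-1 * (complex.Re (q2 z) + complex.Im (q3 z))).

(** The combinations z0 + i z1 and i z2 + z3 vanish on [ideal_minus]. The explicit formula makes the
    relation between phi and psi differentiable. *)
Lemma plus_componentE (R : realType) (z : HC R) (s : quat R) :
  plus_component z (star s) -> s = plus_spinor z.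
Proof.
case=> _ [_ [[a a'] [[b b'] ->]] ->]; case: s => s0 s1 s2 s3.
by rewrite /star /z1of /z2of /plus_spinor; congr Quat => /=; field.
Qed.

(** H is multiplicative and 1 + iI is isotropic. *)
Lemma ideal_minus_isotropic (R : realType) (z : HC R) :
  ideal_minus z -> Hform z z = 0.
Proof.
case=> a [b ->]; rewrite HformM.
have -> : Hform (Quat 1 (ic R) 0 0) (Quat 1 (ic R) 0 0) = 0.
  by rewrite /Hform /= mul_icic; ring.
by rewrite mulr0.
Qed.

Lemma plus_component_neq0 (R : realType) (z : HC R) (s : quat R) :
  SL2C z -> plus_component z (star s) -> s <> 0.
Proof.
move=> z1 [_ [zm zmI zE]] s0.
have star0 : star (0 : quat R) = 0.
  by rewrite /star /z1of /z2of; congr Quat; congr Complex => /=; ring.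
move: z1; rewrite /SL2C zE s0 star0 add0r => z1.
by have /eqP := etrans (esym z1) (ideal_minus_isotropic zmI); rewrite oner_eq0.
Qed.

(** * Projection of the spinor equation *)

Lemma eclM (R : realType) (k l : 'I_3) :
  ecl R k * ecl R l = even (qunit R[i] k * qunit R[i] l).
Proof. by rewrite /ecl clgM mbaseM. Qed.

(** As -4 (i/2)^2 = 1, the sum is that of I_k X I_k - I_k^2 X, that is X + 3X = 4X for imaginary
    X. *)
Lemma ad_clE (R : realType) (x2 x3 : R) :
  ad_cl (cplx x2 *: mbase R i1 + cplx x3 *: mbase R i2)
  = even (2%:R *: (cplx x2 *: mbase R i1 + cplx x3 *: mbase R i2)).
Proof.
rewrite /ad_cl !big_ord_recl big_ord0 addr0 /ecl !clgM.
have n2 : (2%:R : R[i]) != 0 by rewrite pnatr_eq0.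
by congr even; congr Quat => /=; field: (mul_icic R).
Qed.

(** With [d] for the derivative of phi, this is linear algebra at a point: as in [star_clifford],
    e_j . e_1 on phi^+ becomes e_j on psi, and as in [star_ad] the [ad_cl] term becomes + 1/2 X .
    bar psi. *)
Lemma plus_spinor_equation (R : realType) (d z : HC R)
    (w h2 h3 x2 x3 : R) :
  even d + cplx (2%:R^-1 * w) *: (ecl R i1 * ecl R i2 * even z)
  = - (2%:R^-1 *: ((ecl R i1 * (cplx h2 *: ecl R i0)
                    + ecl R i2 * (cplx h3 *: ecl R i0)) * even z))
    - 2%:R^-1 *: (ad_cl (cplx x2 *: mbase R i1 + cplx x3 *: mbase R i2) * even z)
  -> plus_spinor d + (2%:R^-1 * w) *: cliff2 1 0 (cliff2 0 1 (plus_spinor z))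
     = 2%:R^-1 *: (cliff2 x2 x3 (bar (plus_spinor z))
                   - cliff2 h2 h3 (plus_spinor z)).
Proof.
have halfE : 2%:R^-1 = cplx (2%:R^-1) :> R[i].
  by rewrite fmorphV rmorph_nat.
rewrite ad_clE -!scalerAr !eclM halfE => /(congr1 fst)/= /(canRL (addrK _)) ->.
have E2 : 2%:R *: (cplx x2 *: mbase R i1 + cplx x3 *: mbase R i2) =
   Quat 0 0 (Complex 0 x2) (Complex 0 x3).
  by rewrite /mbase !halfE; congr Quat; congr Complex => /=; field.
rewrite E2 {E2 d}.
case: z => [[a a'] [b b'] [c c'] [e e']].
by rewrite /plus_spinor /bar /cliff2; congr Quat => /=; field.
Qed.

(** * Derivatives of local representatives *)

Lemma near_eq_dC (R : realType) (n : nat) (f g : 'rV[R]_n.+1 -> R[i]) x v :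
  (\forall y \near x, f y = g y) -> dC v f x = dC v g x.
Proof.
by move=> fg; congr Complex; apply: near_eq_derive; apply: filterS fg => y ->.
Qed.

Lemma near_eq_dHC (R : realType) (n : nat) (f g : 'rV[R]_n.+1 -> HC R) x v :
  (\forall y \near x, f y = g y) -> dHC v f x = dHC v g x.
Proof.
by move=> fg; congr Quat; apply: near_eq_dC; apply: filterS fg => y ->.
Qed.

Lemma near_eq_dquat (R : realType) (n : nat) (f g : 'rV[R]_n.+1 -> quat R) x v :
  (\forall y \near x, f y = g y) -> dquat v f x = dquat v g x.
Proof.
by move=> fg; congr Quat; apply: near_eq_derive; apply: filterS fg => y ->.
Qed.

Lemma dquat_plus_spinor (R : realType) (n : nat) (U : set 'rV[R]_n.+1)
    (f : 'rV[R]_n.+1 -> HC R) x v : smoothHC_on U f -> U x ->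
  dquat v (fun y => plus_spinor (f y)) x = plus_spinor (dHC v f x).
Proof.
move=> [[f0 g0] [f1 g1] [f2 g2] [f3 g3]] Ux.
have dB (c : R) (g h : 'rV[R]_n.+1 -> R) : smooth_on U g -> smooth_on U h ->
    'D_v (fun y => c * (g y - h y)) x = c * ('D_v g x - 'D_v h x).
  move=> /smooth_on_derivable-/(_ _ v Ux) dg /smooth_on_derivable-/(_ _ v Ux) dh.
  have := is_deriveZ c (is_deriveB (derivableP dg) (derivableP dh)).
  exact: (@derive_val _ _ _ _ _ _ _).
have dD (c : R) (g h : 'rV[R]_n.+1 -> R) : smooth_on U g -> smooth_on U h ->
    'D_v (fun y => c * (g y + h y)) x = c * ('D_v g x + 'D_v h x).
  move=> /smooth_on_derivable-/(_ _ v Ux) dg /smooth_on_derivable-/(_ _ v Ux) dh.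
  have := is_deriveZ c (is_deriveD (derivableP dg) (derivableP dh)).
  exact: (@derive_val _ _ _ _ _ _ _).
rewrite /dquat /plus_spinor /dHC /dC.
by congr Quat; [exact: dB|exact: dD|exact: dB|exact: dD].
Qed.

Lemma normsqE (R : realType) (s : quat R) :
  normsq s = q0 s * q0 s + q1 s * q1 s + q2 s * q2 s + q3 s * q3 s.
Proof. by rewrite /normsq /herm /z1of /z2of /=; ring. Qed.

Lemma derive_normsq (R : realType) (n : nat) (U : set 'rV[R]_n.+1)
    (s : 'rV[R]_n.+1 -> quat R) x v : smoothq_on U s -> U x ->
  'D_v (fun y => normsq (s y)) x
  = 2%:R * complex.Re (herm (dquat v s x) (s x)).
Proof.
move=> [s0 s1 s2 s3] Ux; under eq_fun do rewrite normsqE.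
have is_d (g : 'rV[R]_n.+1 -> R) : smooth_on U g -> is_derive x v g ('D_v g x).
  by move=> sg; apply: derivableP; exact: smooth_on_derivable sg Ux.
have d0 := is_d _ s0; have d1 := is_d _ s1; have d2 := is_d _ s2.
have d3 := is_d _ s3.
have := is_deriveD (is_deriveD (is_deriveD (is_deriveM d0 d0) (is_deriveM d1 d1))
  (is_deriveM d2 d2)) (is_deriveM d3 d3).
move=> /(@derive_val _ _ _ _ _ _ _) /= ->.
rewrite /dquat /herm /z1of /z2of /=.
move: ('D_v _ x) ('D_v _ x) ('D_v _ x) ('D_v _ x) => a b c d.
by rewrite /GRing.scale /=; ring.
Qed.

(** * The equations of psi in a spin frame *)

Lemma pmetric_frame (R : realType) (M : surface R) (F : immersed M)
    (Q : spin_structure F) (a : idx M) x : dom M a x ->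
  [/\ pmetric F a x (fr2 Q a x) (fr2 Q a x) = 1,
      pmetric F a x (fr2 Q a x) (fr3 Q a x) = 0,
      pmetric F a x (fr3 Q a x) (fr2 Q a x) = 0
    & pmetric F a x (fr3 Q a x) (fr3 Q a x) = 1].
Proof.
move=> ax; have h k l := @frame_orthonormal _ _ _ Q a x k l ax.
by split; [exact: (h i1 i1)|exact: (h i1 i2)|exact: (h i2 i1)|exact: (h i2 i2)].
Qed.

Lemma nablaM_corresponds (R : realType) (M : surface R) (F : immersed M)
    (Q : spin_structure F) (phi : USigma_section Q) (psi : SigmaM_section Q) :
  (forall a x v, dom M a x ->
     nablaSigma phi a x v
     = - (2%:R^-1 *: (II_cl Q a x v * usec phi a x))
       - 2%:R^-1 *: (ad_cl (tvec Q a x v) * usec phi a x)) ->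
  corresponds psi phi ->
  forall a x v, dom M a x ->
  nablaM psi a x v = 2%:R^-1 *:
    (cliffM Q a x v (bar (ssec psi a x))
     - cliff2 (sff F a x v (fr2 Q a x)) (sff F a x v (fr3 Q a x)) (ssec psi a x)).
Proof.
move=> nabla_phi psi_phi a x v ax.
have secE y : dom M a y ->
    usec phi a y = even (usec phi a y).1 /\
    ssec psi a y = plus_spinor (usec phi a y).1.
  by move=> ay; have [z -> /plus_componentE ->] := psi_phi a y ay.
have ndom : \forall y \near x, dom M a y.
  by apply: open_nbhs_nbhs; split => //; exact: (@dom_open _ M a).
(* The relations [secE] hold on the chart domain only; it is open, so they may be differentiated at
   [x]. *)
have dphi : dCl v (usec phi a) x = even (dHC v (fun y => (usec phi a y).1) x).
  congr pair; apply: near_eq_dHC; near=> y.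
  by have [|-> _] := secE y; first by near: y.
have dpsi : dquat v (ssec psi a) x
    = plus_spinor (dHC v (fun y => (usec phi a y).1) x).
  rewrite -(dquat_plus_spinor v (usec_smooth phi a).1 ax).
  by apply: near_eq_dquat; near=> y; have [|] := secE y; first by near: y.
have [phiE psiE] := secE x ax.
have := nabla_phi a x v ax; rewrite /nablaSigma /II_cl /tvec dphi phiE.
move=> /plus_spinor_equation; by rewrite -dpsi -psiE.
Unshelve. all: by end_near.
Qed.

(** J and K square to -1 and anticommute: the trace survives, the two [h23] terms cancel, and [b] is
    counted twice with factor -1/2. *)
Lemma cliff2_contraction (R : realType) (h22 h23 h33 : R) (s b : quat R) :
  cliff2 1 0 (2%:R^-1 *: (cliff2 1 0 b - cliff2 h22 h23 s))
  + cliff2 0 1 (2%:R^-1 *: (cliff2 0 1 b - cliff2 h23 h33 s))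
  = (2%:R^-1 * (h22 + h33)) *: s - b.
Proof.
case: s b => [a a' a2 a3] [c c' c2 c3].
by rewrite /cliff2; congr Quat => /=; field.
Qed.

(** The real part of [herm] is the Euclidean product, for which left multiplication by I, J or K is
    skew; this removes the [w], [h2] and [h3] terms. The [b] term stays: [b] will be [bar s], which
    also involves a right multiplication. *)
Lemma herm_spinor_equation (R : realType) (x2 x3 h2 h3 w : R) (d s b : quat R) :
  d + w *: cliff2 1 0 (cliff2 0 1 s)
    = 2%:R^-1 *: (cliff2 x2 x3 b - cliff2 h2 h3 s) ->
  2%:R * complex.Re (herm d s) = complex.Re (herm (cliff2 x2 x3 b) s).
Proof.
move=> /(canRL (addrK _)) ->.
case: s b => [a a' a2 a3] [c c' c2 c3].
by rewrite /cliff2 /herm /z1of /z2of /=; field.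
Qed.

Set Strict Implicit.
Unset Implicit Arguments.

Theorem proposition9p1 (R : realType) (M : surface R) (F : immersed M)
    (Q : spin_structure F) (phi : USigma_section Q) (psi : SigmaM_section Q) :
  (forall a x v, dom M a x ->
     nablaSigma phi a x v
     = - (2%:R^-1 *: (II_cl Q a x v * usec phi a x))
       - 2%:R^-1 *: (ad_cl (tvec Q a x v) * usec phi a x)) ->
  corresponds psi phi ->
  [/\ forall a x, dom M a x ->
        dirac_op psi a x = mean_curvature Q a x *: ssec psi a x - bar (ssec psi a x),
      forall a x v, dom M a x ->
        'D_v (fun y => normsq (ssec psi a y)) x
        = complex.Re (herm (cliffM Q a x v (bar (ssec psi a x))) (ssec psi a x))
    & forall a x, dom M a x -> ssec psi a x <> 0].
Proof.
move=> nabla_phi psi_phi.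
have nabla_psi := nablaM_corresponds nabla_phi psi_phi.
split=> [a x ax|a x v ax|a x ax].
- have [g22 g23 g32 g33] := pmetric_frame Q ax.
  rewrite /dirac_op !(nabla_psi _ _ _ ax) /cliffM g22 g23 g32 g33.
  (* The e_3 term carries [sff] at (e_3, e_2); the contraction needs the same off-diagonal
     coefficient in both terms. *)
  by rewrite (sffC F (fr3 Q a x) (fr2 Q a x) ax) cliff2_contraction.
- have -> := derive_normsq v (ssec_smooth psi a) ax.
  exact: herm_spinor_equation (nabla_psi a x v ax).
(* The splitting of [z] is consumed by [apply]; it remains to see that [z] is in SL_2(C), which
   holds as [even] is injective. *)
have [z zE] := psi_phi a x ax; apply: plus_component_neq0.
have [g gSL gE] := usec_spin phi ax.
by move: zE; rewrite gE => -[<-].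
Qed.
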